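(* Let $\mathcal{L}$ be the set of formulas of the Logic of Resources and Capabilities LRC. For all $X\subseteq\mathcal{L}$ and $A\in\mathcal{L}$, if $X\not\vdash_{\mathrm{LRC}}A$, then $X\not\models_{\mathrm{LRC}}A$.
   Context: LANGUAGE. Fix countable disjoint sets $\mathsf{AtProp}$ (atomic propositions) and $\mathsf{AtRes}$ (atomic resources). Resource terms: $\alpha::=a\in\mathsf{AtRes}\mid 1\mid 0\mid\alpha\cdot\alpha\mid\alpha\sqcup\alpha\mid\alpha\sqcap\alpha$. Formulas (the set $\mathcal{L}$): $A::=p\in\mathsf{AtProp}\mid\top\mid\bot\mid A\vee A\mid A\wedge A\mid A\to A\mid\alpha\vartriangleright A\mid\Diamond A\mid\Diamond_r\alpha\mid\alpha\vartriangleright_r\alpha$. Here $\vartriangleright$ takes a resource and a formula, $\Diamond$ a formula, $\Diamond_r$ a resource, $\vartriangleright_r$ two resources; all four produce formulas. $\Diamond,\Diamond_r,\vartriangleright,\vartriangleright_r$ bind more strongly than $\wedge,\vee$, which bind more strongly than $\to$. HILBERT SYSTEM H.LRC. Resource entailment $\alpha\vdash\beta$ is the least preorder on resource terms such that: (R1) $\sqcup$ and $\sqcap$ are join and meet and distribute over each other; (R2) $\cdot$ is associative with unit $1$ (up to mutual entailment); (R3) $\alpha\vdash1$ and $0\vdash\alpha$; (R4) $\alpha\cdot(\beta\sqcup\gamma)\vdash(\alpha\cdot\beta)\sqcup(\alpha\cdot\gamma)$ and $(\beta\sqcup\gamma)\cdot\alpha\vdash(\beta\cdot\alpha)\sqcup(\gamma\cdot\alpha)$;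 (MF, MF') if $\alpha\vdash\beta$ then $\alpha\cdot\gamma\vdash\beta\cdot\gamma$ and $\gamma\cdot\alpha\vdash\gamma\cdot\beta$. The set of LRC-theorems is the least set of formulas containing the axioms of intuitionistic propositional logic and all instances of: (D1) $\Diamond(A\vee B)\leftrightarrow\Diamond A\vee\Diamond B$; (D2) $\Diamond\bot\leftrightarrow\bot$; (D3) $\Diamond_r(\alpha\sqcup\beta)\leftrightarrow\Diamond_r\alpha\vee\Diamond_r\beta$; (D4) $\Diamond_r0\leftrightarrow\bot$; (B1) $(\alpha\sqcup\beta)\vartriangleright A\leftrightarrow\alpha\vartriangleright A\wedge\beta\vartriangleright A$; (B2) $0\vartriangleright A$; (B3) $\alpha\vartriangleright(\beta\vartriangleright A)\to(\alpha\cdot\beta)\vartriangleright A$; (B4) $(\alpha\sqcup\beta)\vartriangleright_r\gamma\leftrightarrow\alpha\vartriangleright_r\gamma\wedge\beta\vartriangleright_r\gamma$; (B5) $0\vartriangleright_r\alpha$; (B6) $\alpha\vartriangleright_r(\beta\sqcap\gamma)\leftrightarrow\alpha\vartriangleright_r\beta\wedge\alpha\vartriangleright_r\gamma$; (B7) $\alpha\vartriangleright_r1$; (BD1) $\Diamond_r\alpha\wedge\alpha\vartriangleright A\to\Diamond A$; (BD2) $\alpha\vartriangleright_r\beta\to\alpha\vartriangleright\Diamond_r\beta$; closed under modus ponens, uniform substitution and the rules: if $A\to B$ is a theorem, so are $\alpha\vartriangleright A\to\alpha\vartriangleright B$ (MB) and $\Diamond A\to\Diamond B$ (MD); if $\alpha\vdash\beta$,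 then $\beta\vartriangleright A\to\alpha\vartriangleright A$ (AB), $\Diamond_r\alpha\to\Diamond_r\beta$ (MD'), $\gamma\vartriangleright_r\alpha\to\gamma\vartriangleright_r\beta$ (MB'), $\beta\vartriangleright_r\gamma\to\alpha\vartriangleright_r\gamma$ (AB') are theorems. $X\vdash_{\mathrm{LRC}}A$ means that $\bigwedge X_0\to A$ is an LRC-theorem for some finite $X_0\subseteq X$ (the empty conjunction being $\top$). ALGEBRAS. A heterogeneous LRC-algebra is $F=(\mathbb{A},\mathbb{Q},\vartriangleright,\Diamond,\vartriangleright_r,\Diamond_r)$ where $\mathbb{A}$ is a Heyting algebra, $\mathbb{Q}=(Q,\sqcup,\sqcap,\cdot,0,1)$ is a bounded distributive lattice with an associative binary operation $\cdot$ preserving finite joins in each coordinate and having the lattice top $1$ as two-sided unit, and $\vartriangleright:\mathbb{Q}\times\mathbb{A}\to\mathbb{A}$, $\Diamond:\mathbb{A}\to\mathbb{A}$, $\vartriangleright_r:\mathbb{Q}\times\mathbb{Q}\to\mathbb{A}$, $\Diamond_r:\mathbb{Q}\to\mathbb{A}$ satisfy the (quasi-)inequalities corresponding to all axioms and rules of LRC, i.e.: $\Diamond$ and $\Diamond_r$ preserve finite joins (including the empty one); $\vartriangleright$ is monotone in the second coordinate, and $(\alpha\sqcup\beta)\vartriangleright u=\alpha\vartriangleright u\wedge\beta\vartriangleright u$, $0\vartriangleright u=\top$; $\vartriangleright_r$ turns finite joins in the first coordinate into meets and preserves finite meets in the second coordinate (including empty ones); $\alpha\vartriangleright(\beta\vartriangleright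 u)\le(\alpha\cdot\beta)\vartriangleright u$; $\Diamond_r\alpha\wedge\alpha\vartriangleright u\le\Diamond u$; $\alpha\vartriangleright_r\beta\le\alpha\vartriangleright\Diamond_r\beta$. An algebraic LRC-model is such an $F$ with maps $v_{\mathsf{Fm}}:\mathsf{AtProp}\to\mathbb{A}$ and $v_{\mathsf{Res}}:\mathsf{AtRes}\to\mathbb{Q}$, extended homomorphically to all formulas and resource terms. $X\models_{\mathrm{LRC}}A$ means: for every algebraic LRC-model and every $u\in\mathbb{A}$, if $u\le v_{\mathsf{Fm}}(B)$ for all $B\in X$ then $u\le v_{\mathsf{Fm}}(A)$. (For $X=\{B\}$ this says $v_{\mathsf{Fm}}(B)\le v_{\mathsf{Fm}}(A)$ in every model.) *)

(* Defs.v *)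
From HB Require Import structures.
From mathcomp Require Import all_boot all_order.
From mathcomp Require Export classical_sets.
From Stdlib Require List.

Set Implicit Arguments.
Unset Strict Implicit.
Unset Printing Implicit Defensive.

Import Order.TTheory.

Declare Scope res_scope.
Delimit Scope res_scope with res.
Declare Scope formula_scope.
Delimit Scope formula_scope with form.

(** * Language *)

Inductive res (AtRes : Type) : Type :=
| RAtom of AtRes
| ROne
| RZero
| RMul of res AtRes & res AtRes
| RJoin of res AtRes & res AtRes
| RMeet of res AtRes & res AtRes.

Arguments ROne {AtRes}.
Arguments RZero {AtRes}.

Bind Scope res_scope with res.
Notation "1" := ROne : res_scope.
Notation "0" := RZero : res_scope.
Notation "a * b" := (RMul a b) : res_scope.
Notation "a `|` b" := (RJoin a b) : res_scope.
Notation "a `&` b" := (RMeet a b) : res_scope.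

Inductive formula (AtProp AtRes : Type) : Type :=
| Atom of AtProp
| Top
| Bot
| Or of formula AtProp AtRes & formula AtProp AtRes
| And of formula AtProp AtRes & formula AtProp AtRes
| Imp of formula AtProp AtRes & formula AtProp AtRes
| Box of res AtRes & formula AtProp AtRes
| Dia of formula AtProp AtRes
| DiaR of res AtRes
| BoxR of res AtRes & res AtRes.

Arguments Atom {AtProp AtRes}.
Arguments Top {AtProp AtRes}.
Arguments Bot {AtProp AtRes}.
Arguments Or {AtProp AtRes}.
Arguments And {AtProp AtRes}.
Arguments Imp {AtProp AtRes}.
Arguments Dia {AtProp AtRes}.
Arguments DiaR {AtProp AtRes} a%_res_scope.
Arguments Box {AtProp AtRes} a%_res_scope A%_formula_scope.
Arguments BoxR {AtProp AtRes} (a b)%_res_scope.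

Definition Iff AtProp AtRes (A B : formula AtProp AtRes) :=
  And (Imp A B) (Imp B A).

Bind Scope formula_scope with formula.
Reserved Notation "a |> A" (at level 45, right associativity).
Reserved Notation "a |>r b" (at level 45, no associativity).
Reserved Notation "A <==> B" (at level 56, no associativity).
Notation "A `|` B" := (Or A B) : formula_scope.
Notation "A `&` B" := (And A B) : formula_scope.
Notation "A ==> B" := (Imp A B) : formula_scope.
Notation "A <==> B" := (Iff A B) : formula_scope.
Notation "a |> A" := (Box a A) : formula_scope.
Notation "a |>r b" := (BoxR a b) : formula_scope.

Fixpoint res_subst (AtRes : Type) (t : AtRes -> res AtRes) (a : res AtRes)
    : res AtRes :=
  match a with
  | RAtom x => t x
  | ROne => 1
  | RZero => 0
  | RMul b c => res_subst t b * res_subst t c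
  | RJoin b c => res_subst t b `|` res_subst t c
  | RMeet b c => res_subst t b `&` res_subst t c
  end%res.

Fixpoint subst (AtProp AtRes : Type) (s : AtProp -> formula AtProp AtRes)
    (t : AtRes -> res AtRes) (A : formula AtProp AtRes)
    : formula AtProp AtRes :=
  match A with
  | Atom p => s p
  | Top => Top
  | Bot => Bot
  | Or B C => subst s t B `|` subst s t C
  | And B C => subst s t B `&` subst s t C
  | Imp B C => subst s t B ==> subst s t C
  | Box a B => res_subst t a |> subst s t B
  | Dia B => Dia (subst s t B)
  | DiaR a => DiaR (res_subst t a)
  | BoxR a b => res_subst t a |>r res_subst t b
  end%form.

(** * Hilbert system *)

Local Open Scope res_scope.

Inductive res_entails (AtRes : Type) : res AtRes -> res AtRes -> Prop :=
| ent_refl a : res_entails a a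
| ent_trans b a c : res_entails a b -> res_entails b c -> res_entails a c
| ent_joinl a b : res_entails a (a `|` b)
| ent_joinr a b : res_entails b (a `|` b)
| ent_join a b c :
    res_entails a c -> res_entails b c -> res_entails (a `|` b) c
| ent_meetl a b : res_entails (a `&` b) a
| ent_meetr a b : res_entails (a `&` b) b
| ent_meet a b c :
    res_entails c a -> res_entails c b -> res_entails c (a `&` b)
(* the converses of the two distributive laws hold in every lattice *)
| ent_meet_join a b c :
    res_entails (a `&` (b `|` c)) ((a `&` b) `|` (a `&` c))
| ent_join_meet a b c :
    res_entails ((a `|` b) `&` (a `|` c)) (a `|` (b `&` c))
| ent_mulA a b c : res_entails (a * (b * c)) ((a * b) * c)
| ent_mulAV a b c : res_entails ((a * b) * c) (a * (b * c))
| ent_mul1l a : res_entails (1 * a) a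
| ent_mul1lV a : res_entails a (1 * a)
| ent_mul1r a : res_entails (a * 1) a
| ent_mul1rV a : res_entails a (a * 1)
| ent_one a : res_entails a 1
| ent_zero a : res_entails 0 a
| ent_mul_joinr a b c : res_entails (a * (b `|` c)) ((a * b) `|` (a * c))
| ent_mul_joinl a b c : res_entails ((b `|` c) * a) ((b * a) `|` (c * a))
| ent_MF a b c : res_entails a b -> res_entails (a * c) (b * c)
| ent_MF' a b c : res_entails a b -> res_entails (c * a) (c * b).

Local Open Scope formula_scope.

Inductive ipc_axiom (AtProp AtRes : Type) : formula AtProp AtRes -> Prop :=
| ipc_K A B : ipc_axiom (A ==> B ==> A)
| ipc_S A B C : ipc_axiom ((A ==> B ==> C) ==> (A ==> B) ==> A ==> C)
| ipc_andl A B : ipc_axiom (A `&` B ==> A)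
| ipc_andr A B : ipc_axiom (A `&` B ==> B)
| ipc_and A B : ipc_axiom (A ==> B ==> A `&` B)
| ipc_orl A B : ipc_axiom (A ==> A `|` B)
| ipc_orr A B : ipc_axiom (B ==> A `|` B)
| ipc_or A B C : ipc_axiom ((A ==> C) ==> (B ==> C) ==> A `|` B ==> C)
| ipc_bot A : ipc_axiom (Bot ==> A)
| ipc_top : ipc_axiom Top.

Inductive lrc_axiom (AtProp AtRes : Type) : formula AtProp AtRes -> Prop :=
| ax_D1 A B : lrc_axiom (Dia (A `|` B) <==> Dia A `|` Dia B)
| ax_D2 : lrc_axiom (Dia Bot <==> Bot)
| ax_D3 a b : lrc_axiom (DiaR (a `|` b) <==> DiaR a `|` DiaR b)
| ax_D4 : lrc_axiom (DiaR 0 <==> Bot)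
| ax_B1 a b A : lrc_axiom ((a `|` b) |> A <==> (a |> A) `&` (b |> A))
| ax_B2 A : lrc_axiom (0 |> A)
| ax_B3 a b A : lrc_axiom (a |> (b |> A) ==> (a * b) |> A)
| ax_B4 a b c : lrc_axiom ((a `|` b) |>r c <==> (a |>r c) `&` (b |>r c))
| ax_B5 a : lrc_axiom (0 |>r a)
| ax_B6 a b c : lrc_axiom (a |>r (b `&` c) <==> (a |>r b) `&` (a |>r c))
| ax_B7 a : lrc_axiom (a |>r 1)
| ax_BD1 a A : lrc_axiom (DiaR a `&` (a |> A) ==> Dia A)
| ax_BD2 a b : lrc_axiom (a |>r b ==> a |> DiaR b).

Inductive lrc_theorem (AtProp AtRes : Type) : formula AtProp AtRes -> Prop :=
| thm_ipc A : ipc_axiom A -> lrc_theorem A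
| thm_lrc A : lrc_axiom A -> lrc_theorem A
| thm_mp A B : lrc_theorem (A ==> B) -> lrc_theorem A -> lrc_theorem B
| thm_subst s t A : lrc_theorem A -> lrc_theorem (subst s t A)
| thm_MB a A B : lrc_theorem (A ==> B) -> lrc_theorem (a |> A ==> a |> B)
| thm_MD A B : lrc_theorem (A ==> B) -> lrc_theorem (Dia A ==> Dia B)
| thm_AB a b A : res_entails a b -> lrc_theorem (b |> A ==> a |> A)
| thm_MD' a b : res_entails a b -> lrc_theorem (DiaR a ==> DiaR b)
| thm_MB' a b c : res_entails a b -> lrc_theorem (c |>r a ==> c |>r b)
| thm_AB' a b c : res_entails a b -> lrc_theorem (b |>r c ==> a |>r c).

Definition bigAnd (AtProp AtRes : Type) (s : seq (formula AtProp AtRes)) :=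
  foldr And Top s.

(* Finite subsets of [X] are listed by sequences of elements of [X]. *)
Definition lrc_derives (AtProp AtRes : Type) (X : set (formula AtProp AtRes))
    (A : formula AtProp AtRes) : Prop :=
  exists2 X0 : seq (formula AtProp AtRes),
    List.Forall X X0 & lrc_theorem (bigAnd X0 ==> A).

Local Close Scope formula_scope.
Local Close Scope res_scope.

(** * Algebraic semantics *)

(* MathComp orders are boolean-valued on a [choiceType]; classically every
   bounded distributive lattice carries such a structure. *)

Local Open Scope order_scope.

HB.mixin Record TBDistrLattice_isHeyting (d : Order.disp_t) T
    of Order.TBDistrLattice d T := {
  himp : T -> T -> T;
  le_himp : forall x y z : T, (x <= himp y z) = (x `&` y <= z)
}.

#[short(type="heytingType")]
HB.structure Definition Heyting (d : Order.disp_t) :=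
  { T of TBDistrLattice_isHeyting d T & Order.TBDistrLattice d T }.

(* The unit of the multiplication is the lattice top. *)
HB.mixin Record TBDistrLattice_isResource (d : Order.disp_t) T
    of Order.TBDistrLattice d T := {
  rmul : T -> T -> T;
  rmulA : associative rmul;
  rmul1x : left_id \top rmul;
  rmulx1 : right_id \top rmul;
  rmulUx : forall a b c : T, rmul (a `|` b) c = rmul a c `|` rmul b c;
  rmulxU : forall a b c : T, rmul a (b `|` c) = rmul a b `|` rmul a c;
  rmul0x : left_zero \bot rmul;
  rmulx0 : right_zero \bot rmul
}.

#[short(type="resourceType")]
HB.structure Definition Resource (d : Order.disp_t) :=
  { T of TBDistrLattice_isResource d T & Order.TBDistrLattice d T }.

Record lrcAlgebra (dA dQ : Order.disp_t) := LrcAlgebra {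
  fm_sort : heytingType dA;
  res_sort : resourceType dQ;
  box : res_sort -> fm_sort -> fm_sort;
  dia : fm_sort -> fm_sort;
  boxr : res_sort -> res_sort -> fm_sort;
  diar : res_sort -> fm_sort;
  diaU : forall u v, dia (u `|` v) = dia u `|` dia v;
  dia0 : dia \bot = \bot;
  diarU : forall a b, diar (a `|` b) = diar a `|` diar b;
  diar0 : diar \bot = \bot;
  le_box : forall a u v, u <= v -> box a u <= box a v;
  boxUx : forall a b u, box (a `|` b) u = box a u `&` box b u;
  box0x : forall u, box \bot u = \top;
  boxrUx : forall a b c, boxr (a `|` b) c = boxr a c `&` boxr b c;
  boxr0x : forall a, boxr \bot a = \top;
  boxrxI : forall a b c, boxr a (b `&` c) = boxr a b `&` boxr a c;
  boxrx1 : forall a, boxr a \top = \top;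
  box_box : forall a b u, box a (box b u) <= box (rmul a b) u;
  diar_box : forall a u, diar a `&` box a u <= dia u;
  boxr_box : forall a b, boxr a b <= box a (diar b)
}.

Fixpoint res_val (dQ : Order.disp_t) (Q : resourceType dQ) (AtRes : Type)
    (v : AtRes -> Q) (a : res AtRes) : Q :=
  match a with
  | RAtom x => v x
  | ROne => \top
  | RZero => \bot
  | RMul b c => rmul (res_val v b) (res_val v c)
  | RJoin b c => res_val v b `|` res_val v c
  | RMeet b c => res_val v b `&` res_val v c
  end.

Record lrcModel (AtProp AtRes : Type) (dA dQ : Order.disp_t) := LrcModel {
  model_alg :> lrcAlgebra dA dQ;
  val_prop : AtProp -> fm_sort model_alg;
  val_res : AtRes -> res_sort model_alg
}.

Fixpoint fm_val (AtProp AtRes : Type) (dA dQ : Order.disp_t)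
    (M : lrcModel AtProp AtRes dA dQ) (A : formula AtProp AtRes) : fm_sort M :=
  let rv := res_val (@val_res _ _ _ _ M) in
  match A with
  | Atom p => val_prop M p
  | Top => \top
  | Bot => \bot
  | Or B C => fm_val M B `|` fm_val M C
  | And B C => fm_val M B `&` fm_val M C
  | Imp B C => himp (fm_val M B) (fm_val M C)
  | Box a B => box (rv a) (fm_val M B)
  | Dia B => dia (fm_val M B)
  | DiaR a => diar (rv a)
  | BoxR a b => boxr (rv a) (rv b)
  end.

Definition lrc_consequence (AtProp AtRes : Type)
    (X : set (formula AtProp AtRes)) (A : formula AtProp AtRes) : Prop :=
  forall (dA dQ : Order.disp_t) (M : lrcModel AtProp AtRes dA dQ)
    (u : fm_sort M),
    (forall B, X B -> u <= fm_val M B) -> u <= fm_val M A.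

(* Main.v *)
Require Import Defs.
From mathcomp Require Import all_boot classical_sets.
From HB Require Import structures.
From mathcomp Require Import all_order boolp.

(** The Lindenbaum algebra does not suffice when [X] is infinite, since the
    meet of [X] need not exist in it, and quotienting formulas by provability
    from [X] is not compatible with [Dia] and [Box].  Instead, the algebra of
    formulas is a reduced power of the Lindenbaum algebra, indexed by formulas
    modulo the filter generated by the sets [{C | C entails B}] for [B]
    derivable from [X], while resource terms are only taken up to mutual
    entailment.  All the conditions defining LRC-algebras are
    quasi-inequalities, hence survive the reduced power.  The class of the
    identity function is a lower bound of [X], and lies below [A] only if [X]
    derives [A]. *)

Set Implicit Arguments.
Unset Strict Implicit.
Unset Printing Implicit Defensive.

Import Order.TTheory.
Local Open Scope quotient_scope.
Local Open Scope order_scope.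

Local Notation disp := (Order.Disp tt tt).

(** * Preordered distributive lattices and their quotients by mutual comparability *)

Record preLattice := PreLattice {
  pl_sort :> Type;
  ple : pl_sort -> pl_sort -> Prop;
  pmeet : pl_sort -> pl_sort -> pl_sort;
  pjoin : pl_sort -> pl_sort -> pl_sort;
  ptop : pl_sort;
  pbot : pl_sort;
  ple_refl : forall x, ple x x;
  ple_trans : forall y x z, ple x y -> ple y z -> ple x z;
  ple_meetl : forall x y, ple (pmeet x y) x;
  ple_meetr : forall x y, ple (pmeet x y) y;
  ple_meet : forall x y z, ple z x -> ple z y -> ple z (pmeet x y);
  ple_joinl : forall x y, ple x (pjoin x y);
  ple_joinr : forall x y, ple y (pjoin x y);
  ple_join : forall x y z, ple x z -> ple y z -> ple (pjoin x y) z;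
  ple_top : forall x, ple x ptop;
  ple_bot : forall x, ple pbot x;
  ple_distr : forall x y z,
    ple (pmeet x (pjoin y z)) (pjoin (pmeet x y) (pmeet x z))
}.

Section Quotient.
Variable P : preLattice.

Definition peq (x y : P) := ple x y /\ ple y x.

Lemma peq_refl x : peq x x. Proof. by split; apply: ple_refl. Qed.

(** Classical choice supplies the boolean relation and the [choiceType] structure that the quotient
    and its canonical representatives require. *)
Definition peqb : rel {classic P} := fun x y => `[< peq x y >].

Lemma peqb_refl : reflexive peqb.
Proof. by move=> x; apply/asboolP/peq_refl. Qed.

Lemma peqb_sym : symmetric peqb.
Proof. by move=> x y; apply: asbool_equiv_eq; split=> -[]. Qed.

Lemma peqb_trans : transitive peqb.
Proof.
move=> y x z /asboolP[xy yx] /asboolP[yz zy]; apply/asboolP.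
by split; [apply: ple_trans yz | apply: ple_trans yx].
Qed.

Definition peqb_equiv := EquivRel peqb peqb_refl peqb_sym peqb_trans.

Definition quot := {eq_quot peqb_equiv}.
HB.instance Definition _ := Choice.copy quot {eq_quot peqb_equiv}.

Definition cls (x : P) : quot := \pi_{eq_quot peqb_equiv} (x : {classic P}).
Definition rep (x : quot) : P := repr (x : {eq_quot peqb_equiv}).

Lemma repK : cancel rep cls.
Proof. exact: reprK. Qed.

Lemma cls_eq x y : peq x y -> cls x = cls y.
Proof. by move=> xy; apply/eqmodP/asboolP. Qed.

Lemma rep_cls x : peq (rep (cls x)) x.
Proof.
have: cls (rep (cls x)) = cls x by rewrite repK.
by move=> /eqmodP/asboolP.
Qed.

Lemma clsP (K : quot -> Prop) : (forall x, K (cls x)) -> forall x, K x.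
Proof. by move=> Kcls x; rewrite -[x]repK. Qed.

Definition qle : rel quot := fun x y => `[< ple (rep x) (rep y) >].

Lemma qle_refl : reflexive qle.
Proof. by move=> x; apply/asboolP/ple_refl. Qed.

Lemma qle_anti : antisymmetric qle.
Proof.
move=> x y /andP[/asboolP xy /asboolP yx].
by rewrite -[x]repK -[y]repK; apply: cls_eq.
Qed.

Lemma qle_trans : transitive qle.
Proof.
by move=> y x z /asboolP xy /asboolP yz; apply/asboolP/(ple_trans xy).
Qed.

HB.instance Definition _ :=
  Order.Le_isPOrder.Build disp quot
    qle_refl qle_anti qle_trans.

Lemma qleE (x y : quot) : (x <= y) = `[< ple (rep x) (rep y) >].
Proof. by []. Qed.

Lemma cls_leE x y : (cls x <= cls y) = `[< ple x y >].
Proof.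
have [x1 x2] := rep_cls x; have [y1 y2] := rep_cls y.
apply: asbool_equiv_eq; split=> xy.
  exact: (ple_trans x2 (ple_trans xy y1)).
exact: (ple_trans x1 (ple_trans xy y2)).
Qed.

Lemma cls_le x y : (cls x <= cls y) <-> ple x y.
Proof. by rewrite cls_leE; split=> /asboolP. Qed.

Definition qmeet (x y : quot) : quot := cls (pmeet (rep x) (rep y)).
Definition qjoin (x y : quot) : quot := cls (pjoin (rep x) (rep y)).

Lemma qmeetP (x y z : quot) : (x <= qmeet y z) = (x <= y) && (x <= z).
Proof.
rewrite /qmeet -{1}[x]repK cls_leE !qleE -asbool_and.
apply: asbool_equiv_eq; split=> [xyz|[]]; last exact: ple_meet.
split; apply: ple_trans xyz _; [exact: ple_meetl | exact: ple_meetr].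
Qed.

Lemma qjoinP (x y z : quot) : (qjoin x y <= z) = (x <= z) && (y <= z).
Proof.
rewrite /qjoin -{1}[z]repK cls_leE !qleE -asbool_and.
apply: asbool_equiv_eq; split=> [xyz|[]]; last exact: ple_join.
split; apply: ple_trans xyz; [exact: ple_joinl | exact: ple_joinr].
Qed.

HB.instance Definition _ :=
  Order.POrder_MeetJoin_isLattice.Build disp quot
    qmeetP qjoinP.

Lemma cls_meet x y : cls x `&` cls y = cls (pmeet x y).
Proof.
apply/le_anti/andP; split.
  apply/cls_le/ple_meet; apply/cls_le; [exact: leIl | exact: leIr].
rewrite lexI; apply/andP.
by split; apply/cls_le; [apply: ple_meetl | apply: ple_meetr].
Qed.

Lemma cls_join x y : cls x `|` cls y = cls (pjoin x y).
Proof.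
apply/le_anti/andP; split; last first.
  apply/cls_le/ple_join; apply/cls_le; [exact: leUl | exact: leUr].
rewrite leUx; apply/andP.
by split; apply/cls_le; [apply: ple_joinl | apply: ple_joinr].
Qed.

Lemma qmeetUl : @left_distributive quot quot Order.meet Order.join.
Proof.
elim/clsP=> x; elim/clsP=> y; elim/clsP=> z.
rewrite ![_ `&` cls z]meetC; apply/le_anti/andP; split; last first.
  (* This inequality holds in every lattice; the converse is [ple_distr]. *)
  by rewrite leUx !leI2 ?leUl ?leUr.
rewrite !(cls_join, cls_meet); exact/cls_le/ple_distr.
Qed.

HB.instance Definition _ :=
  Order.Lattice_Meet_isDistrLattice.Build disp quot qmeetUl.

Lemma qle0x (x : quot) : cls (pbot P) <= x.
Proof. by elim/clsP: x => x; apply/cls_le/ple_bot. Qed.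

Lemma qlex1 (x : quot) : x <= cls (ptop P).
Proof. by elim/clsP: x => x; apply/cls_le/ple_top. Qed.

HB.instance Definition _ :=
  Order.hasBottom.Build disp quot qle0x.
HB.instance Definition _ :=
  Order.hasTop.Build disp quot qlex1.

Lemma cls_bot : cls (pbot P) = \bot. Proof. by []. Qed.
Lemma cls_top : cls (ptop P) = \top. Proof. by []. Qed.

End Quotient.

Definition qmap (P R : preLattice) (f : P -> R) (x : quot P) : quot R :=
  cls (f (rep x)).

Lemma qmapE (P R : preLattice) (f : P -> R) :
  (forall x y, ple x y -> ple (f x) (f y)) ->
  forall x, qmap f (cls x) = cls (f x).
Proof.
move=> fmono x; have [xl xr] := rep_cls x.
by apply: cls_eq; split; apply: fmono.
Qed.

Definition qmap2 (P R S : preLattice) (f : P -> R -> S)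
  (x : quot P) (y : quot R) : quot S := cls (f (rep x) (rep y)).

(** Compatibility is asked for [peq] rather than [ple], which also covers operations antitone in an
    argument, such as implication and the boxes. One inequality suffices because [peq] is
    symmetric. *)
Lemma qmap2E (P R S : preLattice) (f : P -> R -> S) :
  (forall x x' y y', peq x x' -> peq y y' -> ple (f x y) (f x' y')) ->
  forall x y, qmap2 f (cls x) (cls y) = cls (f x y).
Proof.
move=> fmono x y; have [xl xr] := rep_cls x; have [yl yr] := rep_cls y.
by apply: cls_eq; split; apply: fmono.
Qed.

(** * Resource terms modulo mutual entailment *)

Section ResourceQuotient.
Variable AtRes : Type.
Local Open Scope res_scope.

Definition res_pre : preLattice :=
  PreLattice (@ent_refl AtRes) (@ent_trans AtRes) (@ent_meetl AtRes)
    (@ent_meetr AtRes) (@ent_meet AtRes) (@ent_joinl AtRes) (@ent_joinr AtRes)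
    (@ent_join AtRes) (@ent_one AtRes) (@ent_zero AtRes)
    (@ent_meet_join AtRes).

Definition resQ := quot res_pre.
HB.instance Definition _ := Order.TBDistrLattice.on resQ.

Definition resQ_mul : resQ -> resQ -> resQ :=
  @qmap2 res_pre res_pre res_pre (@RMul AtRes).

Lemma resQ_mulE (a b : res_pre) :
  resQ_mul (cls a) (cls b) = cls (a * b : res_pre).
Proof.
apply: qmap2E => x x' y y' [xx' _] [yy' _] /=.
exact: ent_trans (ent_MF _ xx') (ent_MF' _ yy').
Qed.

Lemma resQ_mulA : associative resQ_mul.
Proof.
elim/clsP=> a; elim/clsP=> b; elim/clsP=> c; rewrite !resQ_mulE.
by apply: cls_eq; split; constructor.
Qed.

Lemma resQ_mul1x : left_id (\top : resQ)%O resQ_mul.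
Proof.
by elim/clsP=> a; rewrite resQ_mulE; apply: cls_eq; split; constructor.
Qed.

Lemma resQ_mulx1 : right_id (\top : resQ)%O resQ_mul.
Proof.
by elim/clsP=> a; rewrite resQ_mulE; apply: cls_eq; split; constructor.
Qed.

Lemma resQ_mulUx (x y z : resQ) :
  resQ_mul (x `|` y)%O z = (resQ_mul x z `|` resQ_mul y z)%O.
Proof.
elim/clsP: x => a; elim/clsP: y => b; elim/clsP: z => c.
rewrite cls_join !resQ_mulE cls_join; apply: cls_eq; split.
  by constructor.
by apply: ent_join; apply: ent_MF; constructor.
Qed.

Lemma resQ_mulxU (x y z : resQ) :
  resQ_mul x (y `|` z)%O = (resQ_mul x y `|` resQ_mul x z)%O.
Proof.
elim/clsP: x => a; elim/clsP: y => b; elim/clsP: z => c.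
rewrite cls_join !resQ_mulE cls_join; apply: cls_eq; split.
  by constructor.
by apply: ent_join; apply: ent_MF'; constructor.
Qed.

(* [0 * a] entails [0 * 1], as [a] entails [1]. *)
Lemma resQ_mul0x : left_zero (\bot : resQ)%O resQ_mul.
Proof.
elim/clsP=> a; rewrite resQ_mulE; apply: cls_eq; split; last by constructor.
apply: ent_trans (ent_mul1r _); apply: ent_MF'; exact: ent_one.
Qed.

Lemma resQ_mulx0 : right_zero (\bot : resQ)%O resQ_mul.
Proof.
elim/clsP=> a; rewrite resQ_mulE; apply: cls_eq; split; last by constructor.
apply: ent_trans (ent_mul1l _); apply: ent_MF; exact: ent_one.
Qed.

HB.instance Definition _ :=
  TBDistrLattice_isResource.Build disp resQ resQ_mulA
    resQ_mul1x resQ_mulx1 resQ_mulUx resQ_mulxU resQ_mul0x resQ_mulx0.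

End ResourceQuotient.

(** * Intuitionistic reasoning inside the Hilbert system *)

Section Hilbert.
Variables AtProp AtRes : Type.
Local Open Scope formula_scope.
Implicit Types A B C D : formula AtProp AtRes.
Notation thm := (@lrc_theorem AtProp AtRes).

Lemma thm_weaken A B : thm A -> thm (B ==> A).
Proof. by apply: thm_mp; apply: thm_ipc; constructor. Qed.

Lemma thm_app A B C : thm (C ==> A ==> B) -> thm (C ==> A) -> thm (C ==> B).
Proof. by move=> CAB; apply/thm_mp/(thm_mp _ CAB)/thm_ipc; constructor. Qed.

Lemma thm_imp_refl A : thm (A ==> A).
(* The combinator S K K: both premises are instances of K. *)
Proof. by apply: (@thm_app (A ==> A)); apply: thm_ipc; constructor. Qed.

Lemma thm_imp_trans B A C : thm (A ==> B) -> thm (B ==> C) -> thm (A ==> C).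
Proof. by move=> AB BC; apply: thm_app AB; apply: thm_weaken. Qed.

Lemma thm_andl A B : thm (A `&` B ==> A).
Proof. by apply: thm_ipc; constructor. Qed.

Lemma thm_andr A B : thm (A `&` B ==> B).
Proof. by apply: thm_ipc; constructor. Qed.

Lemma thm_and A B C : thm (C ==> A) -> thm (C ==> B) -> thm (C ==> A `&` B).
Proof.
move=> CA; apply: thm_app; apply: thm_imp_trans CA _.
by apply: thm_ipc; constructor.
Qed.

Lemma thm_orl A B : thm (A ==> A `|` B).
Proof. by apply: thm_ipc; constructor. Qed.

Lemma thm_orr A B : thm (B ==> A `|` B).
Proof. by apply: thm_ipc; constructor. Qed.

Lemma thm_or A B C : thm (A ==> C) -> thm (B ==> C) -> thm (A `|` B ==> C).
Proof.
by move=> imp_AC; apply/thm_mp/(thm_mp _ imp_AC)/thm_ipc; constructor.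
Qed.

Lemma thm_curry A B C : thm (A `&` B ==> C) -> thm (A ==> B ==> C).
Proof.
move=> ABC; apply: (@thm_imp_trans (B ==> A `&` B)).
  by apply: thm_ipc; constructor.
by apply: thm_mp (thm_weaken B ABC); apply: thm_ipc; constructor.
Qed.

Lemma thm_uncurry A B C : thm (A ==> B ==> C) -> thm (A `&` B ==> C).
Proof.
move=> ABC; apply: thm_app (thm_andr _ _).
exact: thm_imp_trans (thm_andl _ _) ABC.
Qed.

Lemma thm_andC A B : thm (A `&` B ==> B `&` A).
Proof. by apply: thm_and; [apply: thm_andr | apply: thm_andl]. Qed.

(** Conjunction with [A] has an implication as right adjoint, hence commutes with disjunction:
    currying reduces the claim to a case analysis on [B] and [C]. *)
Lemma thm_distr A B C : thm (A `&` (B `|` C) ==> (A `&` B) `|` (A `&` C)).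
Proof.
apply: thm_imp_trans (thm_andC _ _) _; apply: thm_uncurry.
apply: thm_or; apply: thm_curry; apply: thm_imp_trans (thm_andC _ _) _.
  exact: thm_orl.
exact: thm_orr.
Qed.

Lemma thm_iff A B : thm (A <==> B) -> thm (A ==> B) /\ thm (B ==> A).
Proof.
by move=> AB; split; apply: thm_mp AB; [apply: thm_andl | apply: thm_andr].
Qed.

(** Lets two derivations from finite parts of [X] be merged into one. *)
Lemma thm_bigAnd_cat (s t : seq (formula AtProp AtRes)) :
  thm (bigAnd (s ++ t) ==> bigAnd s `&` bigAnd t).
Proof.
elim: s => [|A s IHs] /=.
  by apply/thm_and/thm_imp_refl/thm_weaken/thm_ipc; constructor.
apply: thm_and; last first.
  exact: thm_imp_trans (thm_andr _ _) (thm_imp_trans IHs (thm_andr _ _)).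
apply/thm_and/(thm_imp_trans (thm_andr _ _))/(thm_imp_trans IHs).
  exact: thm_andl.
exact: thm_andl.
Qed.

(** * Derivability from a set and the filter it generates *)

Variable X : set (formula AtProp AtRes).

Lemma derives_imp A B : lrc_derives X A -> thm (A ==> B) -> lrc_derives X B.
Proof. by move=> [s Xs sA] AB; exists s => //; apply: thm_imp_trans AB. Qed.

Lemma derives_and A B :
  lrc_derives X A -> lrc_derives X B -> lrc_derives X (A `&` B).
Proof.
move=> [s Xs sA] [t Xt tB]; exists (s ++ t); first by apply/List.Forall_app.
apply: thm_imp_trans (thm_bigAnd_cat _ _) _; apply: thm_and.
  exact: thm_imp_trans (thm_andl _ _) sA.
exact: thm_imp_trans (thm_andr _ _) tB.
Qed.

Lemma derives_top : lrc_derives X Top.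
Proof. by exists [::] => //; apply: thm_imp_refl. Qed.

Lemma derives_hyp A : X A -> lrc_derives X A.
Proof. by move=> XA; exists [:: A]; [constructor | apply: thm_andl]. Qed.

(** Membership in the filter. A single [C] suffices as witness, because formulas derivable from [X]
    are closed under conjunction and the generating sets thus form a base. *)
Definition eventually (K : set (formula AtProp AtRes)) :=
  exists2 C, lrc_derives X C & forall D, thm (D ==> C) -> K D.

Lemma eventuallyT (K : set (formula AtProp AtRes)) :
  (forall C, K C) -> eventually K.
Proof. by move=> KT; exists Top => //; apply: derives_top. Qed.

(** Closure of the filter under intersections and supersets in one statement; it transfers any rule
    with two premises from the indices to the reduced power. *)
Lemma eventually2 (K L M : set (formula AtProp AtRes)) :
  (forall C, K C -> L C -> M C) -> eventually K -> eventually L -> eventually M.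
Proof.
move=> KLM [C XC KC] [D XD LD]; exists (C `&` D); first exact: derives_and.
move=> E ECD; apply: KLM.
  exact: KC (thm_imp_trans ECD (thm_andl _ _)).
exact: LD (thm_imp_trans ECD (thm_andr _ _)).
Qed.

Lemma eventually1 (K L : set (formula AtProp AtRes)) :
  (forall C, K C -> L C) -> eventually K -> eventually L.
Proof.
move=> KL evK; apply: (eventually2 _ evK evK) => C KC _.
exact: KL.
Qed.

End Hilbert.

(** * The reduced power as a Heyting algebra *)

Section ReducedPower.
Variables (AtProp AtRes : Type) (X : set (formula AtProp AtRes)).
Local Notation form := (formula AtProp AtRes).
Local Notation thm := (@lrc_theorem AtProp AtRes).

Definition fm_le (f g : form -> form) :=
  eventually X (fun C => thm (f C ==> g C)%form).

Lemma fm_leT (f g : form -> form) :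
  (forall C, thm (f C ==> g C)%form) -> fm_le f g.
Proof. exact: eventuallyT. Qed.

Program Definition fm_pre : preLattice := @PreLattice (form -> form) fm_le
  (fun f g C => f C `&` g C)%form (fun f g C => f C `|` g C)%form
  (fun=> Top) (fun=> Bot) _ _ _ _ _ _ _ _ _ _ _.
Next Obligation. by apply: fm_leT => C; apply: thm_imp_refl. Qed.
Next Obligation. by apply: eventually2 H H0 => C; apply: thm_imp_trans. Qed.
Next Obligation. by apply: fm_leT => C; apply: thm_andl. Qed.
Next Obligation. by apply: fm_leT => C; apply: thm_andr. Qed.
Next Obligation. by apply: eventually2 H H0 => C; apply: thm_and. Qed.
Next Obligation. by apply: fm_leT => C; apply: thm_orl. Qed.
Next Obligation. by apply: fm_leT => C; apply: thm_orr. Qed.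
Next Obligation. by apply: eventually2 H H0 => C; apply: thm_or. Qed.
Next Obligation.
by apply: fm_leT => C; apply: thm_weaken; apply: thm_ipc; constructor.
Qed.
Next Obligation. by apply: fm_leT => C; apply: thm_ipc; constructor. Qed.
Next Obligation. by apply: fm_leT => C; apply: thm_distr. Qed.

Definition fmQ := quot fm_pre.
HB.instance Definition _ := Order.TBDistrLattice.on fmQ.

Lemma cls_fm_le (f g : fm_pre) :
  (forall C, thm (f C ==> g C)%form) -> (cls f <= cls g)%O.
Proof. by move=> fg; apply/cls_le/fm_leT. Qed.

(** An axiom instance is provable at every index, so the whole index set serves as the filter
    element. *)
Lemma cls_fm_eq (f g : fm_pre) :
  (forall C, thm (f C <==> g C)%form) -> cls f = cls g.
Proof.
by move=> fg; apply: cls_eq; split; apply: fm_leT => C; case: (thm_iff (fg C)).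
Qed.

Lemma cls_fm_top (f : fm_pre) : (forall C, thm (f C)) -> cls f = \top%O.
Proof.
move=> fT; apply/le_anti; rewrite lex1 /=.
by apply: cls_fm_le => C; apply: thm_weaken.
Qed.

Definition fm_imp : fmQ -> fmQ -> fmQ :=
  @qmap2 fm_pre fm_pre fm_pre (fun f g C => f C ==> g C)%form.

Lemma fm_impE (f g : fm_pre) :
  fm_imp (cls f) (cls g) = cls (P := fm_pre) (fun C => f C ==> g C)%form.
Proof.
apply: qmap2E => {}f f' {}g g' [_ f'f] [gg' _].
(* Implication is antitone on the left, hence [f'f] is used backwards there and [gg'] forwards on
   the right. *)
apply: eventually2 f'f gg' => C f'f gg'; apply: thm_curry.
apply: thm_imp_trans gg'; apply: thm_app (thm_andl _ _) _.
exact: thm_imp_trans (thm_andr _ _) f'f.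
Qed.

(** Residuation holds at each index separately, so both inequalities are witnessed by the same
    filter elements. *)
Lemma le_fm_imp (x y z : fmQ) : (x <= fm_imp y z)%O = (x `&` y <= z)%O.
Proof.
elim/clsP: x => f; elim/clsP: y => g; elim/clsP: z => h.
rewrite fm_impE cls_meet !cls_leE; apply: asbool_equiv_eq.
by split; apply: eventually1 => C; [apply: thm_uncurry | apply: thm_curry].
Qed.

HB.instance Definition _ :=
  TBDistrLattice_isHeyting.Build disp fmQ le_fm_imp.

(** * Modal operators on the reduced power *)

Local Notation rpre := (res_pre AtRes).
Local Notation resQ := (resQ AtRes).

(** Resources do not vary with the index: a class of resource terms acts at all indices [C] at once,
    while the formula argument is read off at [C]. *)
Definition fm_box : resQ -> fmQ -> fmQ :=
  @qmap2 rpre fm_pre fm_pre (fun a f C => a |> f C)%form.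
Definition fm_dia : fmQ -> fmQ :=
  @qmap fm_pre fm_pre (fun f C => Dia (f C)).
Definition fm_boxr : resQ -> resQ -> fmQ :=
  @qmap2 rpre rpre fm_pre (fun a b _ => a |>r b)%form.
Definition fm_diar : resQ -> fmQ :=
  @qmap rpre fm_pre (fun a _ => DiaR a).

Lemma fm_boxE (a : rpre) (f : fm_pre) :
  fm_box (cls a) (cls f) = cls (P := fm_pre) (fun C => a |> f C)%form.
Proof.
apply: qmap2E => {}a a' {}f f' [_ a'a] [ff' _].
(* Only the comparison of formulas depends on the index; [a'a] is an outright entailment. *)
apply: eventually1 ff' => C ff'.
exact: thm_imp_trans (thm_MB _ ff') (thm_AB _ a'a).
Qed.

Lemma fm_diaE (f : fm_pre) :
  fm_dia (cls f) = cls (P := fm_pre) (fun C => Dia (f C)).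
Proof.
apply: qmapE => {}f g; apply: eventually1 => C; exact: thm_MD.
Qed.

Lemma fm_boxrE (a b : rpre) :
  fm_boxr (cls a) (cls b) = cls (P := fm_pre) (fun=> a |>r b)%form.
Proof.
apply: qmap2E => {}a a' {}b b' [_ a'a] [bb' _]; apply: fm_leT => C.
exact: thm_imp_trans (thm_MB' _ _ bb') (thm_AB' _ _ a'a).
Qed.

Lemma fm_diarE (a : rpre) : fm_diar (cls a) = cls (P := fm_pre) (fun=> DiaR a).
Proof.
by apply: qmapE => {}a b ab; apply: fm_leT => C; apply: thm_MD'.
Qed.

Program Definition lind_alg : lrcAlgebra disp disp :=
  @LrcAlgebra _ _ fmQ resQ fm_box fm_dia fm_boxr fm_diar
    _ _ _ _ _ _ _ _ _ _ _ _ _ _.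
Next Obligation.
elim/clsP: u => f; elim/clsP: v => g; rewrite cls_join !fm_diaE cls_join.
by apply: cls_fm_eq => C; apply: thm_lrc; constructor.
Qed.
Next Obligation.
rewrite -cls_bot fm_diaE.
by apply: cls_fm_eq => C; apply: thm_lrc; constructor.
Qed.
Next Obligation.
elim/clsP: a => a; elim/clsP: b => b; rewrite cls_join !fm_diarE cls_join.
by apply: cls_fm_eq => C; apply: thm_lrc; constructor.
Qed.
Next Obligation.
rewrite -!cls_bot fm_diarE.
by apply: cls_fm_eq => C; apply: thm_lrc; constructor.
Qed.
Next Obligation.
(* The condition here is conditional: its premise holds on a filter set, and the rule MB is applied
   at each index of that set. *)
elim/clsP: a => a; elim/clsP: u H => f; elim/clsP: v => g; rewrite !fm_boxE.
move=> /cls_le fg; apply/cls_le; apply: eventually1 fg => C; exact: thm_MB.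
Qed.
Next Obligation.
elim/clsP: a => a; elim/clsP: b => b; elim/clsP: u => f.
rewrite cls_join !fm_boxE cls_meet.
by apply: cls_fm_eq => C; apply: thm_lrc; constructor.
Qed.
Next Obligation.
elim/clsP: u => f; rewrite -cls_bot fm_boxE.
by apply: cls_fm_top => C; apply: thm_lrc; constructor.
Qed.
Next Obligation.
elim/clsP: a => a; elim/clsP: b => b; elim/clsP: c => c.
rewrite cls_join !fm_boxrE cls_meet.
by apply: cls_fm_eq => C; apply: thm_lrc; constructor.
Qed.
Next Obligation.
elim/clsP: a => a; rewrite -cls_bot fm_boxrE.
by apply: cls_fm_top => C; apply: thm_lrc; constructor.
Qed.
Next Obligation.
elim/clsP: a => a; elim/clsP: b => b; elim/clsP: c => c.
rewrite cls_meet !fm_boxrE cls_meet.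
by apply: cls_fm_eq => C; apply: thm_lrc; constructor.
Qed.
Next Obligation.
elim/clsP: a => a; rewrite -cls_top fm_boxrE.
by apply: cls_fm_top => C; apply: thm_lrc; constructor.
Qed.
Next Obligation.
elim/clsP: a => a; elim/clsP: b => b; elim/clsP: u => f.
(* The product [rmul] of the algebra is [resQ_mul] by definition. *)
rewrite [X in (_ <= fm_box X _)%O]resQ_mulE 2!fm_boxE fm_boxE.
by apply: cls_fm_le => C; apply: thm_lrc; constructor.
Qed.
Next Obligation.
elim/clsP: a => a; elim/clsP: u => f; rewrite fm_diarE fm_boxE fm_diaE cls_meet.
by apply: cls_fm_le => C; apply: thm_lrc; constructor.
Qed.
Next Obligation.
elim/clsP: a => a; elim/clsP: b => b; rewrite fm_diarE fm_boxE fm_boxrE.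
by apply: cls_fm_le => C; apply: thm_lrc; constructor.
Qed.

(** * The countermodel and its truth lemma *)

Definition lind_model : lrcModel AtProp AtRes _ _ :=
  @LrcModel AtProp AtRes _ _ lind_alg
    (fun p => cls (P := fm_pre) (fun=> Atom p) : fmQ)
    (fun a => cls (RAtom a : rpre) : resQ).

Lemma lind_res_val (a : rpre) :
  res_val (@val_res _ _ _ _ lind_model) a = cls a.
Proof.
elim: a => //= a -> b ->.
- exact: resQ_mulE.
- exact: cls_join.
- exact: cls_meet.
Qed.

(** Atoms are sent to constant functions, and every operation acts index by index, so it keeps
    functions constant. *)
Lemma lind_fm_val (A : form) :
  fm_val lind_model A = cls (P := fm_pre) (fun=> A).
Proof.
elim: A => //=.
- by move=> A -> B ->; apply: cls_join.
- by move=> A -> B ->; apply: cls_meet.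
- by move=> A -> B ->; apply: fm_impE.
- by move=> a A ->; rewrite lind_res_val; apply: fm_boxE.
- by move=> A ->; apply: fm_diaE.
- by move=> a; rewrite lind_res_val; apply: fm_diarE.
- by move=> a b; rewrite !lind_res_val; apply: fm_boxrE.
Qed.

(** At index [C] the identity takes the value [C], so the comparison says that all formulas
    entailing some formula derivable from [X] entail [A]. *)
Lemma lind_le_val (A : form) :
  ((cls (id : fm_pre) : fm_sort lind_model) <= fm_val lind_model A)%O <->
  lrc_derives X A.
Proof.
rewrite lind_fm_val; split.
  (* The index [C] lies in its own generating set, which gives [C ==> A]. *)
  move=> /cls_le[C XC CA]; apply: derives_imp XC (CA C _).
  exact: thm_imp_refl.
(* Here [A] itself generates the required filter set. *)
by move=> XA; apply/cls_le; exists A.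
Qed.

End ReducedPower.

Theorem proposition2p3 (AtProp AtRes : countType)
    (X : set (formula AtProp AtRes)) (A : formula AtProp AtRes) :
  ~ lrc_derives X A -> ~ lrc_consequence X A.
Proof.
(* The consequence is instantiated at the class of [id] in the model built from [X]; it is a lower
   bound of [X] because members of [X] are derivable. *)
move=> nXA XA; apply: nXA; apply/lind_le_val; apply: XA => B XB.
exact/lind_le_val/derives_hyp.
Qed.
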